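(* Let $k$ be a positive integer such that $p=8k-1$ is prime. Let $R_{p+2}=\{1,\ldots,p+2\}$ and let $\binom{R_{p+2}}{3}$ be the set of all 3-element subsets of $R_{p+2}$. Then there exists a coloring of $\binom{R_{p+2}}{3}$ into $p$ colors, i.e. a map $c:\binom{R_{p+2}}{3}\to C$ with $C$ a set of $p$ elements, such that $c(x)\neq c(y)$ for any two sets $x,y\in\binom{R_{p+2}}{3}$ with $|x\cap y|=2$. *)

(* Defs.v *)
From mathcomp Require Import all_boot.
Set Implicit Arguments.
Unset Strict Implicit.
Unset Printing Implicit Defensive.

(* {1, ..., n}, as a subset of 'I_n.+1 = {0, ..., n} *)
Definition R (n : nat) : {set 'I_n.+1} := [set i : 'I_n.+1 | 0 < i].

Definition triples (n : nat) : {set {set 'I_n.+1}} :=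
  [set x : {set 'I_n.+1} | x \subset R n & #|x| == 3].

(* triples n as a type, used as the domain of the coloring *)
Definition triple (n : nat) : Type :=
  {x : {set 'I_n.+1} | x \in triples n}.

(* Main.v *)
(** Schreiber's and Wilson's large sets of Steiner triple systems.  Identify the
    points with F_p together with two points at infinity, and colour with F_p.
    A triple of F_p gets the sum of its elements, the triple of x and both
    infinities gets 3x, and the triple of x, y and one infinity gets 2x + y or
    x + 2y, depending on the infinity and on whether x - y is a square.  This is
    well defined because -1 is not a square modulo p = 8k - 1, and it separates
    triples with two common points because 2 is a square. *)
Require Import Defs.
From mathcomp Require Import all_boot all_algebra finfield.
From mathcomp Require Import ring zify.

Set Implicit Arguments.
Unset Strict Implicit.
Unset Printing Implicit Defensive.

Import GRing.Theory.

Section SetColoring.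
Variables (T : finType) (C : Type) (g : T -> T -> T -> C).

(** The colour is read off the enumeration of [A]; [c0] is a filler for sets that do not have three
    elements. *)
Definition set3_color (c0 : C) (A : {set T}) : C :=
  if enum A is [:: a; b; d] then g a b d else c0.

Hypothesis gC12 : forall a b d, a != b -> g a b d = g b a d.
Hypothesis gC23 : forall a b d, b != d -> g a b d = g a d b.

(** The adjacent transpositions [gC12] and [gC23] generate every order in which [enum] may list the
    set. *)
Lemma set3_colorE (c0 : C) (a b d : T) : a != b -> a != d -> b != d ->
  set3_color c0 [set a; b; d] = g a b d.
Proof.
move=> ab ad bd; rewrite /set3_color.
have: perm_eq (enum [set a; b; d]) [:: a; b; d].
  apply: uniq_perm; rewrite ?enum_uniq //= ?inE ?negb_or ?ab ?ad ?bd //.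
  by move=> x; rewrite mem_enum !inE orbA.
move=> ps; have := perm_size ps; have := perm_mem ps; have := perm_uniq ps.
rewrite [uniq [:: a; b; d]]/= !inE negb_or ab ad bd.
case: (enum _) => [|x [|y [|z [|? ?]]]] //= + /[swap] _.
rewrite !inE negb_or !andbT => /andP[/andP[xy xz] yz] mem.
have := mem z; have := mem y; have := mem x; rewrite !inE !eqxx !orbT /=.
(* Assignments that repeat a point contradict distinctness; the five nontrivial permutations
   remain. *)
move=> /esym/or3P[] /eqP ? /esym/or3P[] /eqP ? /esym/or3P[] /eqP ?; subst;
  rewrite ?eqxx // in xy xz yz *.
- by rewrite gC23.
- by rewrite gC12.
- by rewrite gC23 // gC12.
- by rewrite gC12 // gC23.
- by rewrite gC12 // gC23 // gC12.
Qed.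

End SetColoring.

Lemma cards3_meet2 (T : finType) (X Y : {set T}) :
    #|X| = 3 -> #|Y| = 3 -> #|X :&: Y| = 2 ->
  exists a b w w', [/\ X = [set a; b; w], Y = [set a; b; w'],
    uniq [:: a; b; w] & uniq [:: a; b; w'] && (w != w')].
Proof.
move=> cX cY cI; have /eqP/cards2P[a [b [ab eI]]] := cI.
have /eqP/cards1P[w ew] : #|X :\: Y| = 1 by rewrite cardsD cX cI.
have /eqP/cards1P[w' ew'] : #|Y :\: X| = 1 by rewrite cardsD cY setIC cI.
have: w \in X :\: Y by rewrite ew set11.
have: w' \in Y :\: X by rewrite ew' set11.
rewrite !inE => /andP[w'X w'Y] /andP[wY wX].
have: a \in X :&: Y by rewrite eI !inE eqxx.
have: b \in X :&: Y by rewrite eI !inE eqxx orbT.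
rewrite !inE => /andP[bX bY] /andP[aX aY].
have neq x y (Z : {set T}) : x \in Z -> y \notin Z -> x != y.
  by move=> xZ; apply: contraNneq => <-.
exists a, b, w, w'; split.
- by rewrite -eI -ew setID.
- by rewrite -eI -ew' setIC setID.
- by rewrite /= !inE negb_or ab (neq _ _ Y) // (neq _ _ Y).
- by rewrite /= !inE negb_or ab !(neq _ _ X).
Qed.

Section FieldColoring.
Local Open Scope ring_scope.
Variables (F : finFieldType) (s : F -> bool).
(** [s] abstracts the indicator of nonzero squares: -1 is a nonsquare, and 2 is a square. *)
Hypothesis sN : forall x, x != 0 -> s (- x) = ~~ s x.
Hypothesis s2 : forall x, x != 0 -> s (2 * x) = s x.

Let two_neq0 : 2 != 0 :> F.
Proof.
apply/eqP => e2; have := sN (oner_neq0 F).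
have -> : - 1 = 1 :> F by rewrite -[RHS](addrK 1) -[1 + 1]/2 e2 sub0r.
by case: (s 1).
Qed.

(** In characteristic 3, 2 = -1, so [s2] and [sN] would clash at 1. *)
Let three_neq0 : 3 != 0 :> F.
Proof.
apply/eqP => e3; have := sN (oner_neq0 F); rewrite -(s2 (oner_neq0 F)).
have -> : 2 * 1 = - 1 :> F by rewrite -[RHS]add0r -e3; ring.
by case: (s (-1)).
Qed.

Definition edge_color (b : bool) (x y : F) : F :=
  if s (x - y) == b then 2 * x + y else x + 2 * y.

(** The two values under [inr] are the infinities. Three distinct points never reach the last
    clause, so its 0 is arbitrary. *)
Definition point_color (u v w : F + bool) : F :=
  match u, v, w with
  | inl x, inl y, inl z => x + y + z
  | inl x, inl y, inr b | inl x, inr b, inl y | inr b, inl x, inl y =>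
      edge_color b x y
  | inl x, inr _, inr _ | inr _, inl x, inr _ | inr _, inr _, inl x => 3 * x
  | inr _, inr _, inr _ => 0
  end.

(** Swapping the points negates x - y; this flips [s] and so undoes the exchange of the two
    formulas. *)
Lemma edge_colorC b x y : x != y -> edge_color b x y = edge_color b y x.
Proof.
move=> xy; rewrite /edge_color -(opprB x y) sN ?subr_eq0 //.
by case: (s _) b => [] [] /=; ring.
Qed.

Lemma point_colorC12 u v w : u != v -> point_color u v w = point_color v u w.
Proof.
case: u v w => [x|a] [y|b] [z|d] //= xy; first by ring.
by rewrite edge_colorC.
Qed.

Lemma point_colorC23 u v w : v != w -> point_color u v w = point_color u w v.
Proof.
case: u v w => [x|a] [y|b] [z|d] //= xy; first by ring.
by rewrite edge_colorC.
Qed.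

(** The left side is x + y plus one of x and y, and z is neither. *)
Lemma edge_color_neq_sum b x y z :
  x != z -> y != z -> edge_color b x y != x + y + z.
Proof.
move=> xz yz; rewrite /edge_color -subr_eq0; case: (s _ == b).
  by have -> : 2 * x + y - (x + y + z) = x - z; [ring | rewrite subr_eq0].
by have -> : x + 2 * y - (x + y + z) = y - z; [ring | rewrite subr_eq0].
Qed.

Lemma edge_color_neq_triple b x y : x != y -> edge_color b x y != 3 * x.
Proof.
move=> xy; have yx : y - x != 0 by rewrite subr_eq0 eq_sym.
rewrite /edge_color -subr_eq0; case: (s _ == b).
  by have -> : 2 * x + y - 3 * x = y - x by ring.
have -> : x + 2 * y - 3 * x = 2 * (y - x) by ring.
by rewrite mulf_neq0.
Qed.

(** The two infinities receive the two formulas, whose values differ by x - y. *)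
Lemma edge_color_bool_inj x y : x != y -> injective (fun b => edge_color b x y).
Proof.
move=> xy b b'; have ne : 2 * x + y != x + 2 * y.
  by rewrite -subr_eq0; have -> : 2 * x + y - (x + 2 * y) = x - y;
      [ring | rewrite subr_eq0].
rewrite /edge_color; case: (s _) b b' => [] [] [] //= /eqP.
all: by rewrite ?[_ + _ == 2 * x + _]eq_sym (negPf ne).
Qed.

(* In the mixed case 2x + y = x + 2z reads x - y = 2 (x - z), so that x - y and
   x - z are in the same class. *)
Lemma edge_color_inj b x y z : x != y -> x != z ->
  edge_color b x y = edge_color b x z -> y = z.
Proof.
have mixed u v : x != v -> 2 * x + u = x + 2 * v -> s (x - u) = s (x - v).
  move=> xv e; rewrite -[RHS]s2 ?subr_eq0 //; congr s.
  by have -> : x - u = 3 * x - (2 * x + u); [ring | rewrite e; ring].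
move=> xy xz; rewrite /edge_color.
case: eqP => sy; case: eqP => sz.
- by move/addrI.
- by move/(mixed _ _ xz); rewrite sy => /esym.
- by move/esym/(mixed _ _ xy); rewrite sz => /esym.
- by move/addrI/(mulfI two_neq0).
Qed.

Lemma point_color_inj u v w w' : uniq [:: u; v; w] -> uniq [:: u; v; w'] ->
  point_color u v w = point_color u v w' -> w = w'.
Proof.
rewrite /= !inE !negb_or !andbT => /andP[/andP[uv uw] vw] /andP[/andP[_ uw'] vw'].
case: u v w w' uv uw vw uw' vw' => [x|a] [y|b] [z|d] [z'|d'] //= xy xz yz xz' yz'.
- by move/addrI->.
- by move/esym/eqP; rewrite (negPf (edge_color_neq_sum _ _ _)).
- by move/eqP; rewrite (negPf (edge_color_neq_sum _ _ _)).
- by move/(edge_color_bool_inj xy)->.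
- by move/(edge_color_inj xz xz')->.
- by move/eqP; rewrite (negPf (edge_color_neq_triple _ _)).
- by move/esym/eqP; rewrite (negPf (edge_color_neq_triple _ _)).
(* Both third points are the infinity other than [b]. *)
- by case: b d d' yz yz' => [] [] [].
- by move/(edge_color_inj yz yz')->.
- by move/eqP; rewrite (negPf (edge_color_neq_triple _ _)).
- by move/esym/eqP; rewrite (negPf (edge_color_neq_triple _ _)).
- by case: a d d' xz xz' => [] [] [].
- by move/(mulfI three_neq0)->.
- by case: a b d' xy xz' yz' => [] [] [].
- by case: a b d xy xz yz => [] [] [].
- by case: a b d xy xz yz yz' xz' => [] [] [].
Qed.

Lemma field_coloring (X Y : {set F + bool}) :
    #|X| = 3%N -> #|Y| = 3%N -> #|X :&: Y| = 2%N ->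
  set3_color point_color 0 X <> set3_color point_color 0 Y.
Proof.
move=> cX cY cI.
have [u [v [w [w' [-> -> uX /andP[uY /eqP ww']]]]]] := cards3_meet2 cX cY cI.
have colorE t : uniq [:: u; v; t] ->
    set3_color point_color 0 [set u; v; t] = point_color u v t.
  rewrite /= !inE negb_or andbT => /andP[/andP[uv ut] vt].
  exact: (set3_colorE point_colorC12 point_colorC23).
by rewrite !colorE // => /(point_color_inj uX uY).
Qed.

End FieldColoring.

(** The even factors 2, 4, ..., 2n contribute 2^n n!. *)
Lemma fact_double n : (n.*2)`! = (\prod_(i < n) i.*2.+1) * (2 ^ n * n`!).
Proof.
elim: n => [|n IHn]; first by rewrite big_ord0.
rewrite doubleS !factS IHn big_ord_recr /= expnS -!mul2n; ring.
Qed.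

Section QuadraticCharacter.
Local Open Scope ring_scope.
Variables (k p : nat) (k_gt0 : (0 < k)%N) (pE : p = (8 * k - 1)%N).
Hypothesis p_prime : prime p.

Lemma natFp_neq0 n : (0 < n < p)%N -> n%:R != 0 :> 'F_p.
Proof.
move=> /andP[n0 np]; rewrite -(dvdn_pcharf (pchar_Fp p_prime)).
by rewrite gtnNdvd.
Qed.

Lemma factFp_neq0 n : (n < p)%N -> n`!%:R != 0 :> 'F_p.
Proof.
elim: n => [|n IHn] np; first by rewrite fact0 oner_neq0.
by rewrite factS natrM mulf_neq0 //; [exact: natFp_neq0 | exact/IHn/ltnW].
Qed.

(* With n = 2k, the odd number 2i + 1 is congruent to -2 (2n - 1 - i) modulo
   p = 4n - 1, so the odd part of (2n)! is (-2)^n (2n - 1)! / (n - 1)!; hence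
   2 = 4^n. *)
Lemma two_square_Fp : 2 ^+ (4 * k - 1) = 1 :> 'F_p.
Proof.
have [n n2k] : exists n, n = (2 * k)%N by exists (2 * k)%N.
have n_gt0 : (0 < n)%N by lia.
have p4n : p = (4 * n - 1)%N by lia.
have oddE : (\prod_(i < n) i.*2.+1)%:R
    = 2 ^+ n * ((2 * n - 1) ^_ n)%:R :> 'F_p.
  rewrite natr_prod ffact_prod natr_prod.
  (* The sign is free because n = 2k is even. *)
  have -> : 2 ^+ n = (- 2) ^+ n :> 'F_p by rewrite n2k !exprM sqrrN.
  rewrite -[in X in X * _](card_ord n) -prodr_const -big_split /=.
  apply: eq_bigr => i _; have lt_in := ltn_ord i.
  apply/eqP; rewrite -subr_eq0 mulNr opprK -natrM -natrD.
  have -> : (i.*2.+1 + 2 * (2 * n - 1 - i) = p)%N by lia.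
  by rewrite pchar_Fp_0.
have fE : (2 * n)`! = (2 * n * (2 * n - 1)`!)%N.
  have -> : (2 * n = (2 * n - 1).+1)%N by lia.
  by rewrite factS; congr (_ * _`!)%N; lia.
have nE : n`! = (n * (n - 1)`!)%N.
  by rewrite -[in LHS](prednK n_gt0) factS prednK // subn1.
have ffE : ((2 * n - 1) ^_ n * (n - 1)`! = (2 * n - 1)`!)%N.
  rewrite -(@ffact_fact (2 * n - 1) n); last by lia.
  by congr (_ * _`!)%N; lia.
have := fact_double n; rewrite -mul2n fE nE.
move/(congr1 (fun m => m%:R : 'F_p)); rewrite !natrM oddE natrX => e.
have n0 : n%:R != 0 :> 'F_p by apply: natFp_neq0; lia.
have f0 : (2 * n - 1)`!%:R != 0 :> 'F_p by apply: factFp_neq0; lia.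
have two0 : 2 != 0 :> 'F_p by apply: natFp_neq0; lia.
apply: (mulfI two0); rewrite -exprS mulr1.
have -> : (4 * k - 1).+1 = (n + n)%N by lia.
rewrite exprD; apply: (mulIf (mulf_neq0 n0 f0)).
rewrite [RHS]mulrA e -ffE natrM; ring.
Qed.

(** Euler's criterion, as (p - 1)/2 = 4k - 1; 0 counts as a nonsquare. *)
Definition is_square_Fp (x : 'F_p) : bool := x ^+ (4 * k - 1) == 1.

Lemma is_square_FpM2 x : is_square_Fp (2 * x) = is_square_Fp x.
Proof. by rewrite /is_square_Fp exprMn two_square_Fp mul1r. Qed.

(** The exponent is odd, so the sign comes out; by Fermat the power of x is 1 or -1, and these
    differ. *)
Lemma is_square_FpN x : x != 0 -> is_square_Fp (- x) = ~~ is_square_Fp x.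
Proof.
move=> x0; rewrite /is_square_Fp exprNn -signr_odd.
have -> : odd (4 * k - 1) by lia.
rewrite expr1 mulN1r eqr_oppLR.
have two0 : 2 != 0 :> 'F_p by apply: natFp_neq0; lia.
have /eqP : (x ^+ (4 * k - 1)) ^+ 2 = 1.
  rewrite -exprM; apply: (mulfI x0); rewrite -exprS mulr1.
  have -> : ((4 * k - 1) * 2).+1 = #|'F_p| by rewrite card_Fp //; lia.
  exact: expf_card.
rewrite sqrf_eq1 => /orP[] /eqP ->; rewrite ?eqxx /=.
  by rewrite -subr_eq0 opprK -[1 + 1]/(2%:R) (negPf two0).
by rewrite eq_sym -subr_eq0 opprK -[1 + 1]/(2%:R) two0.
Qed.

End QuadraticCharacter.

Theorem theorem1 (k p : nat) (hk : 0 < k) (hpk : p = 8 * k - 1)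
    (hp : prime p) :
  exists (C : finType) (c : triple (p + 2) -> C),
    #|C| = p /\
    forall x y : triple (p + 2), #|val x :&: val y| = 2 -> c x <> c y.
Proof.
pose P : finType := ('F_p + bool)%type.
(* The predecessor shifts 1, ..., p + 2 to the positions of [enum P], so the default is never
   reached; 0 collides with 1, whence injectivity only on [R (p + 2)]. *)
pose f (i : 'I_(p + 2).+1) : P := nth (inr true) (enum P) i.-1.
have f_inj : {in R (p + 2) &, injective f}.
  have sizeP : size (enum P) = p + 2.
    by rewrite -cardT card_sum card_Fp // card_bool.
  move=> i j; rewrite !inE => i0 j0 /eqP.
  have [ltip ltjp] := (ltn_ord i, ltn_ord j).
  rewrite nth_uniq ?enum_uniq ?sizeP //; [|lia|lia].
  by move=> /eqP ij; apply: val_inj => /=; lia.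
exists 'F_p, (fun x : triple (p + 2) =>
  set3_color (point_color (@is_square_Fp k p)) 0%R (f @: val x)); split; first exact: card_Fp.
move=> [x /= xT] [y /= yT] xy2.
move: xT yT; rewrite !inE => /andP[xR /eqP x3] /andP[yR /eqP y3].
have f_injS (A : {set _}) : A \subset R (p + 2) -> {in A &, injective f}.
  by move=> /subsetP AR; apply: sub_in2 f_inj.
apply: field_coloring.
- exact: is_square_FpN.
- by move=> z _; apply: is_square_FpM2.
- by rewrite card_in_imset //; apply: f_injS.
- by rewrite card_in_imset //; apply: f_injS.
(* Injectivity on [R (p + 2)] lets the image commute with the intersection. *)
- rewrite -imsetI; last first.
    by move=> i j /(subsetP xR) iR /(subsetP yR) jR; apply: f_inj.
  rewrite card_in_imset //; apply: f_injS.
  exact: subset_trans (subsetIl _ _) xR.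
Qed.
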